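(* For every $\eta>0$ there is $\varepsilon>0$ such that the following holds for every integer $m\ge 1$. Let $\mathcal P=(\mathcal C,\mathcal A)$ be an $m$-color palette satisfying $\mathcal P_L\not\preceq\mathcal P$ and $\mathcal P_R\not\preceq\mathcal P$, and suppose that $|\mathcal A|\ge E_m-\varepsilon m^3$, where $E_m=\frac{m(m^2-1)}3$. Then there is an ordered digon chain $J$ on $\mathcal C$ such that $$|\mathcal A(\mathcal P)\,\triangle\,\mathcal A(\mathcal P_m^\star(J))|\le\eta m^3.$$
   Context: A palette is a pair $\mathcal P=(\mathcal C,\mathcal A)$ where $\mathcal C$ is a finite set of colors and $\mathcal A=\mathcal A(\mathcal P)\subseteq\mathcal C^3$ (repeated colors allowed); it is an $m$-color palette if $|\mathcal C|=m$. A homomorphism of palettes is a map between color sets sending admissible triples (coordinatewise) to admissible triples; write $\mathcal P\preceq\mathcal P'$ if a homomorphism $\mathcal P\to\mathcal P'$ exists, and $\mathcal P\not\preceq\mathcal P'$ otherwise. Let $\overrightarrow C_3$ be the directed triangle, with vertex set $V$ and arc set $A$, and let $\mathcal C_0=V\sqcup\{c_{uv}:uv\in A\}$ with $c_{uv}$ new distinct colors. Put $\mathcal P_L=(\mathcal C_0,\{(u,v,c_{uv}):uv\in A\})$ and $\mathcal P_R=(\mathcal C_0,\{(c_{uv},u,v):uv\in A\})$. An ordered digon chain on an $m$-element set is a digraph obtained from a linear ordering of the set by splitting it into consecutive blocks of size $2$ (with a final block of size $1$ if $m$ is odd), putting both arcs between the two vertices of each 2-element block, and putting, for every pair of vertices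 in different blocks, exactly the one arc from the vertex of the earlier block to the vertex of the later block. For an ordered digon chain $J$ on a color set $\mathcal C$ with $|\mathcal C|=m$, $\mathcal P_m^\star(J)$ is the palette with color set $\mathcal C$ in which $(x,y,z)$ is admissible iff $yx$ and $yz$ are both arcs of $J$ ($x=z$ allowed). *)

(* Defs.v *)
From HB Require Import structures.
From mathcomp Require Import all_boot all_order all_algebra.
From mathcomp Require Import reals.

Set Implicit Arguments.
Unset Strict Implicit.
Unset Printing Implicit Defensive.

Record palette := Palette {
  color : finType;
  admissible : {set color * color * color}
}.

Definition palette_hom (P Q : palette) (f : color P -> color Q) : Prop :=
  forall x y z : color P,
    (x, y, z) \in admissible P -> (f x, f y, f z) \in admissible Q.

Definition palette_le (P Q : palette) : Prop :=
  exists f : color P -> color Q, palette_hom f.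

Definition dir_triangle : rel 'I_3 := fun u v => v == ordS u.

Definition arc (V : finType) (e : rel V) : finType :=
  {p : V * V | e p.1 p.2}.

(* [inl v] is the vertex v, and [inr a] is the new color c_uv of a = uv. *)
Definition color0 : finType := ('I_3 + arc dir_triangle)%type.

Definition paletteL : palette := @Palette color0
  [set (inl (val a).1, inl (val a).2, inr a) | a : arc dir_triangle].

Definition paletteR : palette := @Palette color0
  [set (inr a, inl (val a).1, inl (val a).2) | a : arc dir_triangle].

(* Positions are counted from 0, so the blocks of consecutive elements of s
   are the fibers of half the position. *)
Definition block (C : eqType) (s : seq C) (x : C) : nat := (index x s)./2.

Definition digon_chain_of (C : eqType) (s : seq C) : rel C := fun x y =>
  (x != y) && (block s x == block s y) || (block s x < block s y).

(* The linear ordering is given by a list of all the elements of C without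
   repetition. *)
Definition ordered_digon_chain (C : finType) (J : rel C) : Prop :=
  exists s : seq C, [/\ uniq s, s =i C & J =2 digon_chain_of s].

Definition chain_palette (C : finType) (J : rel C) : palette := @Palette C
  [set t : C * C * C | let: (x, y, z) := t in J y x && J y z].

Definition symdiff (T : finType) (A B : {set T}) : {set T} :=
  (A :\: B) :|: (B :\: A).

(* Main.v *)
(* An admissible triple (x, y, z) contributes an arc y -> x to a digraph D1 and
   an arc y -> z to a digraph D2 on the colors; the two hypotheses say that D1
   and D2 have no closed walk of length 3.  A k-set spans at most k^2/2 arcs of
   such a digraph, so in any ordering the sum of the first k out-degrees is at
   most the corresponding sum for a digon chain.  Order the colors by
   decreasing d1 + d2 and sum by parts: twice the sum of d1 * d2 falls short of
   2 E_m by at least the total G of the gaps in these inequalities at even k.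
   An arc missing from D1 or D2 between two blocks of the chain is counted in
   G as many times as the distance between the blocks, so all but few arcs of
   the chain are present when G is small compared to m^3; when G = 0 all of
   them are, which settles bounded m. *)
Require Import Defs.
From HB Require Import structures.
From mathcomp Require Import all_boot all_order all_algebra.
From mathcomp Require Import reals.
From mathcomp Require Import zify lra.

Set Implicit Arguments.
Unset Strict Implicit.
Unset Printing Implicit Defensive.

(** * Arc counts in digraphs without closed walks of length 3 *)

Definition no_closed_3walk (T : finType) (D : rel T) : Prop :=
  forall x y z, D x y -> D y z -> ~~ D z x.

Definition outdeg (T : finType) (D : rel T) (x : T) : nat := \sum_y D x y.

Lemma no_loop (T : finType) (D : rel T) x : no_closed_3walk D -> D x x = false.
Proof. by move=> nD; apply/negP => Dx; move: (nD _ _ _ Dx Dx); rewrite Dx. Qed.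

(** Remove a digon on [a], [b]: any other vertex [x] has at most two arcs to or from it, since
    [b x], [x a] would close a walk with [a b], and [a x], [x b] one with [b a]. Without digons,
    each pair of vertices spans at most one arc. *)
Lemma arcs_le_half_square (T : finType) (D : rel T) (S : {set T}) :
  no_closed_3walk D ->
  \sum_(x in S) \sum_(y in S) D x y <= (#|S| ^ 2)./2.
Proof.
move=> nD.
have [n le_n] := ubnP #|S|; elim: n S le_n => // n IHn S /ltnSE leSn.
case: (pickP [pred p : T * T |
    [&& p.1 \in S, p.2 \in S, D p.1 p.2 & D p.2 p.1]]) => [[a b] /=|noD].
  case/and4P=> aS bS Dab Dba.
  have ab : b != a by apply: contraTneq Dab => ->; rewrite no_loop.
  have bSa : b \in S :\ a by rewrite in_setD1 ab.
  set S' := S :\ a :\ b.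
  have cardS : #|S| = #|S'|.+2 by rewrite (cardsD1 a) aS (cardsD1 b) bSa.
  have splitS (F : T -> nat) :
      \sum_(x in S) F x = F a + F b + \sum_(x in S') F x.
    by rewrite (big_setD1 a) // (big_setD1 b) //= addnA.
  rewrite splitS; move: (splitS (D a)) (splitS (D b)) => /= -> ->.
  have -> : \sum_(x in S') \sum_(y in S) D x y =
      \sum_(x in S') (D x a + D x b + \sum_(y in S') D x y).
    by apply: eq_bigr => x _; move: (splitS (D x)).
  have hcross : \sum_(x in S') (D a x + D b x + (D x a + D x b)) <= #|S'| * 2.
    rewrite -sum_nat_const; apply: leq_sum => x _.
    have : ~~ (D b x && D x a) by apply/andP => -[/(nD _ _ _ Dab)/negP].
    have : ~~ (D a x && D x b) by apply/andP => -[/(nD _ _ _ Dba)/negP].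
    by do 4 case: (D _ _).
  have := IHn S' ltac:(lia).
  move: hcross; rewrite !big_split /= cardS !no_loop // Dab Dba.
  set s1 := \sum_(_ in _) _; set s2 := \sum_(_ in _) _.
  set s3 := \sum_(_ in _) _; set s4 := \sum_(_ in _) _.
  set s5 := \sum_(_ in _) _; move: s1 s2 s3 s4 s5 #|S'| => *; nia.
(* The diagonal is covered as well: [noD] at [x = y] excludes loops. *)
have : \sum_(x in S) \sum_(y in S) (D x y + D y x) <= #|S| * #|S|.
  rewrite -sum_nat_const; apply: leq_sum => x xS.
  rewrite -[leqRHS]muln1 -sum_nat_const; apply: leq_sum => y yS.
  by have := noD (x, y); rewrite /= xS yS /=; do 2 case: (D _ _).
under eq_bigr do rewrite big_split.
rewrite big_split /= [X in _ + X]exchange_big /= mulnn; lia.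
Qed.

(** * The degree sequence of a digon chain *)

Lemma sum_index (T : finType) (s : seq T) (F : nat -> nat) :
  uniq s -> s =i T -> \sum_(x : T) F (index x s) = \sum_(i < #|T|) F i.
Proof.
move=> us sT.
have szs : size s = #|T| by rewrite -(card_uniqP us); apply: eq_card.
rewrite (perm_big s) /=; last first.
  apply: uniq_perm; rewrite ?index_enum_uniq // => x.
  by rewrite mem_index_enum sT.
rewrite -(big_map (index^~ s) xpredT F) -(big_mkord xpredT) -szs.
congr (\big[_/_]_(_ <- _) _); rewrite /index_iota subn0.
apply: (@eq_from_nth _ 0); rewrite size_map ?size_iota // => i lti.
case: s us lti {sT szs} => // x0 s us lti.
by rewrite (nth_map x0) ?nth_iota ?index_uniq.
Qed.

(** Out-degree of position [i] in a digon chain on [m] vertices: all vertices except itself and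
    those of earlier blocks. For [i < m] nothing is truncated. *)
Definition chain_deg (m i : nat) : nat := m.-1 - i./2.*2.

(** All [k * (m - k)] pairs leaving the first [k] positions are arcs of the chain, and inside them
    the chain attains the maximum of [arcs_le_half_square]. *)
Lemma sum_chain_deg m k : k <= m ->
  \sum_(i < k) chain_deg m i = k * (m - k) + (k ^ 2)./2.
Proof.
elim: k => [|k IHk] ltkm; first by rewrite big_ord0.
transitivity (k * (m - k) + (k ^ 2)./2 + chain_deg m k).
  by rewrite big_ord_recr /= IHk // ltnW.
have -> : (k.+1 ^ 2)./2 = (k ^ 2)./2 + k + odd k.
  by have := odd_double_half k; move: (odd k) k./2 {IHk} => [] q <-; lia.
have [d ->] : exists d, m = k.+1 + d by exists (m - k.+1); lia.
rewrite /chain_deg; have := odd_double_half k; case: (odd k) => /=; lia.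
Qed.

(** The sum is $E_m$. Deleting the first block, two vertices of degree [m.+1], leads from [m.+2] to
    [m]. *)
Lemma sum_chain_deg_sq m :
  3 * \sum_(i < m) chain_deg m i ^ 2 + m = m ^ 3.
Proof.
have [n le_n] := ubnP m; elim: n m le_n => // n IHn [|[|m]] le_n.
- by rewrite big_ord0.
- by rewrite big_ord_recl big_ord0.
rewrite !big_ord_recl /=.
have := IHn m ltac:(lia).
rewrite (eq_bigr (fun i : 'I_m => chain_deg m i ^ 2)); last first.
  by move=> i _; congr (_ ^ 2); rewrite /chain_deg /bump /=; lia.
have -> : chain_deg m.+2 (bump 0 0) = m.+1 by [].
rewrite [chain_deg _ 0]subn0 /=; set S := \sum_(_ < _) _; nia.
Qed.

(** * Degree sums over prefixes of an ordering *)

Definition prefix_set (T : finType) (s : seq T) (k : nat) : {set T} :=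
  [set x | index x s < k].

Lemma sum_prefix (T : finType) (s : seq T) (F : nat -> nat) k :
  uniq s -> s =i T -> k <= #|T| ->
  \sum_(x in prefix_set s k) F (index x s) = \sum_(i < k) F i.
Proof.
move=> us sT lek; rewrite (big_ord_widen _ F lek) big_mkcond /=.
rewrite [RHS]big_mkcond /= -(sum_index (fun i => if i < k then F i else 0) us sT).
by apply: eq_bigr => x _; rewrite inE.
Qed.

Lemma card_prefix (T : finType) (s : seq T) k :
  uniq s -> s =i T -> k <= #|T| -> #|prefix_set s k| = k.
Proof.
move=> us sT lek; rewrite -sum1_card (sum_prefix (fun=> 1) us sT lek).
by rewrite sum1_card card_ord.
Qed.

(** The chain has the most arcs inside the prefix and every arc leaving it, so each leaving pair
    that [D] misses can be charged to the shortfall of its degree sum. *)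
Lemma outdeg_prefix (T : finType) (D : rel T) (s : seq T) k :
  no_closed_3walk D -> uniq s -> s =i T -> k <= #|T| ->
  \sum_(x in prefix_set s k) outdeg D x
    + \sum_(x in prefix_set s k) \sum_(y in ~: prefix_set s k) ~~ D x y
    <= \sum_(x in prefix_set s k) chain_deg #|T| (index x s).
Proof.
move=> nD us sT lek; set S := prefix_set s k.
rewrite (sum_prefix (chain_deg #|T|) us sT lek) sum_chain_deg //.
have cS := card_prefix us sT lek.
have := arcs_le_half_square S nD; rewrite cS.
have : \sum_(x in S) \sum_(y in ~: S) (D x y + ~~ D x y) = k * (#|T| - k).
  under eq_bigr => x _.
    rewrite (eq_bigr (fun=> 1)); last by move=> y _; case: (D x y).
    rewrite sum1_card cardsCs setCK cS.
    over.
  by rewrite sum_nat_const cS.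
under eq_bigr do rewrite big_split.
rewrite big_split /=.
rewrite (_ : \sum_(x in S) outdeg D x = \sum_(x in S) \sum_(y in S) D x y +
   \sum_(x in S) \sum_(y in ~: S) D x y); last first.
  rewrite -big_split /=; apply: eq_bigr => x _; rewrite /outdeg.
  by rewrite (bigID (mem S)) /=; congr addn; apply: eq_bigl => y; rewrite ?inE.
lia.
Qed.

Lemma block_double_lt (T : finType) (s : seq T) x :
  uniq s -> s =i T -> (block s x).*2 < #|T|.
Proof.
move=> us sT; rewrite -(eq_card sT) (card_uniqP us).
have : index x s < size s by rewrite index_mem sT.
by rewrite /block; have := odd_double_half (index x s); lia.
Qed.

Lemma digon_chain_of_leq (T : finType) (s : seq T) x y :
  digon_chain_of s x y = (y != x) && (block s x <= block s y).
Proof.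
rewrite /digon_chain_of eq_sym; case: eqVneq => [->|_] /=; first by rewrite ltnn.
by rewrite [RHS]leq_eqVlt.
Qed.

Lemma outdeg_chain (T : finType) (s : seq T) x :
  uniq s -> s =i T -> outdeg (digon_chain_of s) x = chain_deg #|T| (index x s).
Proof.
move=> us sT; have lt2b := block_double_lt x us sT.
rewrite /outdeg (bigD1 x) //= digon_chain_of_leq eqxx add0n.
have := cardsC (prefix_set s (block s x).*2); rewrite card_prefix 1?ltnW //.
rewrite -sum1_card (bigD1 x) /=; last first.
  rewrite !inE -leqNgt /block; have := odd_double_half (index x s); lia.
rewrite (_ : \sum_(i in ~: _ | i != x) 1 = \sum_(i | i != x) digon_chain_of s x i).
  rewrite /chain_deg -/(block s x); lia.
rewrite big_mkcond /= [RHS]big_mkcond; apply: eq_bigr => y _.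
rewrite digon_chain_of_leq !inE -leqNgt andbC.
have -> : ((block s x).*2 <= index y s) = (block s x <= block s y).
  by rewrite /block; have := odd_double_half (index y s); lia.
by case: (y != x).
Qed.

(** * Summation by parts along a decreasing ordering *)

Lemma ex_sorted_enum (T : finType) (u : T -> nat) :
  exists s : seq T, [/\ uniq s, s =i T &
    forall x y, index x s <= index y s -> u y <= u x].
Proof.
pose r x y := u y <= u x.
have rtr : transitive r by move=> y x z /= xy yz; apply: leq_trans yz xy.
have rtot : total r by move=> x y; apply: leq_total.
exists (sort r (enum T)); split.
- by rewrite sort_uniq enum_uniq.
- by move=> x; rewrite mem_sort mem_enum.
move=> x y lexy; have := sort_sorted rtot (enum T).
move/(sorted_leq_nth rtr (fun x => leqnn (u x)) x).
move/(_ (index x (sort r (enum T))) (index y (sort r (enum T)))).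
by rewrite !inE !index_mem !nth_index !mem_sort ?mem_enum //; apply.
Qed.

Lemma superlevel_prefix (T : finType) (s : seq T) (u : T -> nat) t :
  uniq s -> s =i T -> (forall x y, index x s <= index y s -> u y <= u x) ->
  exists2 k, k <= #|T| & [set x | t < u x] = prefix_set s k.
Proof.
move=> us sT us_sorted; have szs : size s = #|T|.
  by rewrite -(card_uniqP us); apply: eq_card.
exists (find (fun x => u x <= t) s); first by rewrite -szs find_size.
apply/setP => x; rewrite !inE ltnNge; apply/negP/idP => [gtx|ltx lex].
  rewrite ltnNge; apply/negP => lef.
  have fs : find (fun x => u x <= t) s < size s.
    by apply: leq_ltn_trans lef _; rewrite index_mem sT.
  apply: gtx; apply: (leq_trans (n := u (nth x s (find (fun x => u x <= t) s)))).
    by apply: us_sorted; rewrite index_uniq.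
  by have := @nth_find _ x (fun x => u x <= t) s; rewrite has_find => ->.
by have := before_find x ltx; rewrite nth_index ?sT // lex.
Qed.

(* Layer-cake: both sides are summed over the superlevel sets of [u], which
   are prefixes of [s]. *)
Lemma sum_sq_le_prefix (T : finType) (s : seq T) (u g : T -> nat) :
  uniq s -> s =i T -> (forall x y, index x s <= index y s -> u y <= u x) ->
  (forall k, k <= #|T| ->
    \sum_(x in prefix_set s k) u x <= \sum_(x in prefix_set s k) g x) ->
  \sum_x u x ^ 2 <= \sum_x u x * g x.
Proof.
move=> us sT us_sorted le_ug; pose M := \max_x u x.
have layers (f : T -> nat) :
    \sum_x u x * f x = \sum_(t < M) \sum_(x in [set x | t < u x]) f x.
  transitivity (\sum_x \sum_(t < M) if t < u x then f x else 0).
    apply: eq_bigr => x _; rewrite -big_mkcond /=.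
    rewrite -(big_ord_widen M (fun=> f x)) ?sum_nat_const ?card_ord //.
    exact: leq_bigmax.
  rewrite exchange_big; apply: eq_bigr => t _ /=.
  by rewrite [RHS]big_mkcond; apply: eq_bigr => x _; rewrite inE.
under eq_bigr do rewrite -mulnn.
rewrite !layers; apply: leq_sum => t _.
by have [k lek ->] := superlevel_prefix t us sT us_sorted; apply: le_ug.
Qed.

Lemma in_prefix_double (T : finType) (s : seq T) j x :
  (x \in prefix_set s j.*2) = (block s x < j).
Proof. by rewrite inE /block; have := odd_double_half (index x s); lia. Qed.

Lemma sum_prefix_double (T : finType) (s : seq T) (f : T -> nat) h :
  \sum_(j < h.+1) \sum_(x in prefix_set s j.*2) f x
    = \sum_x (h - block s x) * f x.
Proof.
transitivity (\sum_(j < h.+1) \sum_x if block s x < j then f x else 0).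
  apply: eq_bigr => j _; rewrite big_mkcond /=.
  by apply: eq_bigr => x _; rewrite in_prefix_double.
rewrite exchange_big; apply: eq_bigr => x _ /=.
rewrite (eq_bigr (fun j : 'I_h.+1 => (block s x < j) * f x)); last first.
  by move=> j _; case: ifP; rewrite ?mul1n.
rewrite -big_distrl /=; congr (_ * _).
elim: h => [|h IHh]; rewrite big_ord_recr /= ?big_ord0 ?IHh; lia.
Qed.

(** The multiplicity [h - block s x] is half of [d x] up to the parity term [e]. Hence twice the sum
    of the gaps is [2 * \sum_x d x ^ 2 - \sum_x d x * u x] plus the boundary term [e * (X h - Y h)];
    this term is at most one gap, so one copy of the sum survives. *)
Lemma sum_prefix_gap (T : finType) (s : seq T) (u : T -> nat) :
  uniq s -> s =i T ->
  let h := #|T|./2 in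
  let d x := chain_deg #|T| (index x s) in
  let X j := \sum_(x in prefix_set s j.*2) 2 * d x in
  let Y j := \sum_(x in prefix_set s j.*2) u x in
  (forall j, j <= h -> Y j <= X j) ->
  \sum_x d x * u x + \sum_(j < h.+1) (X j - Y j) <= 2 * \sum_x d x ^ 2.
Proof.
move=> us sT h d X Y leYX.
pose e := ~~ odd #|T|.
have dE x : 2 * (h - block s x) = d x + e.
  have := block_double_lt x us sT; rewrite /d /chain_deg -/(block s x) /e /h.
  by have := odd_double_half #|T|; lia.
have full (f : T -> nat) :
    2 * \sum_(j < h.+1) \sum_(x in prefix_set s j.*2) f x =
    \sum_x d x * f x + e * \sum_(x in prefix_set s h.*2) f x.
  rewrite sum_prefix_double big_distrr /=.
  under eq_bigr do rewrite mulnA dE mulnDl.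
  rewrite big_split -big_distrr /=; congr (_ + _).
  (* For even [#|T|] the prefix of length [h.*2] is everything; for odd [#|T|] the term vanishes. *)
  rewrite /e; case oT: (odd #|T|) => //=; congr (_ * _).
  apply: eq_bigl => x; rewrite in_prefix_double.
  have := block_double_lt x us sT; rewrite /h.
  by have := odd_double_half #|T|; rewrite oT; lia.
have := full u; have := full (fun x => 2 * d x).
have -> : \sum_x d x * (2 * d x) = 2 * \sum_x d x ^ 2.
  by rewrite big_distrr; apply: eq_bigr => x _ /=; lia.
rewrite -/(X h) -/(Y h).
have -> : \sum_(j < h.+1) \sum_(x in prefix_set s j.*2) 2 * d x = 
    \sum_(j < h.+1) (X j - Y j) + \sum_(j < h.+1) Y j.
  by rewrite -big_split; apply: eq_bigr => j _ /=; rewrite subnK // leYX // -ltnS.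
have : X h - Y h <= \sum_(j < h.+1) (X j - Y j).
  by rewrite (bigD1 ord_max) //= leq_addr.
have := leYX h (leqnn h); rewrite -/(Y _).
move: (X h) (Y h) (\sum_(j < h.+1) (X j - Y j)) => Xh Yh G.
rewrite /Y; move: (\sum_(j < h.+1) _) (\sum_x d x * _) (\sum_x d x ^ 2) => a b c.
case: e {dE full} => /=; lia.
Qed.


(** The cut at [j] separates [x] from [y] when [block s x < j <= block s y]; truncation gives weight
    0 to pairs that do not go to a later block. *)
Lemma sum_missing_across (T : finType) (D : rel T) (s : seq T) h :
  (forall x, block s x <= h) ->
  \sum_(j < h.+1) \sum_(x in prefix_set s j.*2)
      \sum_(y in ~: prefix_set s j.*2) ~~ D x y
    = \sum_x \sum_y ~~ D x y * (block s y - block s x).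
Proof.
move=> leh.
transitivity (\sum_(j < h.+1) \sum_x \sum_y
    ~~ D x y * ((block s x < j) && (j <= block s y))).
  apply: eq_bigr => j _; rewrite big_mkcond; apply: eq_bigr => x _ /=.
  rewrite in_prefix_double; case: ltnP => /= _; last first.
    by rewrite big1 // => y _; rewrite muln0.
  rewrite big_mkcond; apply: eq_bigr => y _ /=.
  by rewrite in_setC in_prefix_double -leqNgt; case: leqP; rewrite ?muln1 ?muln0.
rewrite exchange_big; apply: eq_bigr => x _ /=.
rewrite exchange_big; apply: eq_bigr => y _ /=.
rewrite -big_distrr /=; congr (_ * _).
have {}leh := leh y; rewrite -(subnKC leh).
elim: (h - block s y) => [|k IHk].
  rewrite addn0; elim: {leh y}(block s y) => [|n IHn].
    by rewrite big_ord_recr big_ord0.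
  rewrite big_ord_recr /= leqnn andbT.
  rewrite (eq_bigr (fun j : 'I_n.+1 => (block s x < j) && (j <= n) : nat)).
    by rewrite IHn; lia.
  by move=> j _; have lejn : j <= n := ltn_ord j; rewrite lejn leqW.
by rewrite addnS big_ord_recr /= IHk; lia.
Qed.

(** * Equality and stability for a pair of digraphs *)

(* Inductively, the vertices of earlier blocks form digons, so an arc back to
   such a vertex [z] would close a walk through the partner of [z]; hence all
   out-neighbours are later in the chain, and the degree count is tight. *)
Lemma chain_sub_of_tight (T : finType) (D1 D2 : rel T) (s : seq T) :
  no_closed_3walk D1 -> no_closed_3walk D2 -> uniq s -> s =i T ->
  (forall j, j <= #|T|./2 ->
    \sum_(x in prefix_set s j.*2) (outdeg D1 x + outdeg D2 x) =
    \sum_(x in prefix_set s j.*2) 2 * chain_deg #|T| (index x s)) ->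
  forall x y, digon_chain_of s x y -> D1 x y && D2 x y.
Proof.
move=> nD1 nD2 us sT tight.
have szs : size s = #|T| by rewrite -(card_uniqP us); apply: eq_card.
suff main n x y : block s x = n -> digon_chain_of s x y -> D1 x y && D2 x y.
  by move=> x y; apply: main.
elim/ltn_ind: n x y => n IHn.
have later D x y : no_closed_3walk D ->
    (forall z t, block s z < n -> digon_chain_of s z t -> D z t) ->
    block s x = n -> D x y -> digon_chain_of s x y.
  move=> nD IH bx Dxy; rewrite digon_chain_of_leq bx.
  have -> /= : y != x by apply: contraTneq Dxy => ->; rewrite no_loop.
  rewrite leqNgt; apply/negP => lty.
  have [t /andP[tNy /eqP bt]] : exists t, (t != y) && (block s t == block s y).
    (* The partner of [y] sits next to it, on the side given by parity; it exists because [x] lies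
       in a later block. *)
    pose i := if odd (index y s) then (index y s).-1 else (index y s).+1.
    have hx : index x s < size s by rewrite index_mem sT.
    have hi : i < size s /\ i != index y s /\ i./2 = (index y s)./2.
      move: lty bx hx; rewrite /block /i; have := odd_double_half (index y s).
      by case: (odd _) => /=; lia.
    exists (nth y s i); apply/andP; split.
      by apply: contraTneq hi.2.1 => <-; rewrite index_uniq ?hi.1 // eqxx.
    by rewrite /block index_uniq ?hi.1 // hi.2.2.
  have Dyt : D y t by apply: IH => //; rewrite digon_chain_of_leq tNy bt leqnn.
  have Dtx : D t x.
    apply: IH; rewrite ?bt // digon_chain_of_leq bt bx ltnW // andbT.
    by apply: contraTneq lty => xt; rewrite -bt -xt bx ltnn.
  by have := nD _ _ _ Dyt Dtx; rewrite Dxy.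
have le1 x y : block s x = n -> D1 x y -> digon_chain_of s x y.
  by apply: later => // z t ltz zt; case/andP: (IHn _ ltz z t erefl zt).
have le2 x y : block s x = n -> D2 x y -> digon_chain_of s x y.
  by apply: later => // z t ltz zt; case/andP: (IHn _ ltz z t erefl zt).
have le_deg (D : rel T) x : (forall y, D x y -> digon_chain_of s x y) ->
    outdeg D x <= chain_deg #|T| (index x s)
      ?= iff [forall y, D x y == digon_chain_of s x y].
  move=> DJ; rewrite -(outdeg_chain x us sT) /outdeg.
  apply: leqif_sum => y _; have := DJ y.
  by case: (D x y) => [->|_] //; case: (digon_chain_of s x y).
move=> x y bx.
(* Otherwise the block is the final singleton, which has no out-arc in the chain. *)
have [ltnh|] := ltnP n #|T|./2; last first.
  move=> lehn; have := outdeg_chain x us sT; rewrite /chain_deg -/(block s x) bx.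
  move=> deg0 Jxy; have : outdeg (digon_chain_of s) x = 0 by lia.
  by rewrite /outdeg (bigD1 y) //= Jxy.
(* Subtracting two consecutive equalities isolates block [n], where the degrees are bounded termwise
   and so are all equal to those of the chain. *)
have := tight n.+1 ltnh; have := tight n (ltnW ltnh).
have split_block (f : T -> nat) : \sum_(z in prefix_set s n.+1.*2) f z =
    \sum_(z in prefix_set s n.*2) f z + \sum_(z | block s z == n) f z.
  rewrite (bigID (fun z => z \in prefix_set s n.*2)) /=; congr (_ + _).
    by apply: eq_bigl => z; rewrite !in_prefix_double; lia.
  by apply: eq_bigl => z; rewrite !in_prefix_double; lia.
rewrite !split_block => -> /addnI eq_block.
have hif z : block s z == n ->
    outdeg D1 z + outdeg D2 z <= 2 * chain_deg #|T| (index z s)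
      ?= iff [forall y, D1 z y == digon_chain_of s z y]
          && [forall y, D2 z y == digon_chain_of s z y].
  move/eqP => bz; rewrite mul2n -addnn.
  by apply: leqif_add; apply: le_deg => t; [apply: le1|apply: le2].
have [_] := leqif_sum hif; rewrite eq_block eqxx => /esym/forall_inP/(_ x).
by rewrite bx eqxx => /(_ isT) /andP[/forallP/(_ y)/eqP -> /forallP/(_ y)/eqP ->] ->.
Qed.

(** With $u = d_1 + d_2$ and chain degrees $d$: $4\sum d_1 d_2 \le \sum u^2 \le 2\sum d u \le 4\sum
    d^2 - 2G$, where [G] is the total gap over even prefixes. The missing arcs leaving a prefix are
    part of its gap. *)
Lemma chain_stability (T : finType) (D1 D2 : rel T) :
  no_closed_3walk D1 -> no_closed_3walk D2 ->
  exists (s : seq T) (G : nat), [/\ uniq s, s =i T,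
    2 * \sum_x outdeg D1 x * outdeg D2 x + G
      <= 2 * \sum_x chain_deg #|T| (index x s) ^ 2,
    \sum_x \sum_y (~~ D1 x y + ~~ D2 x y) * (block s y - block s x) <= G &
    G = 0 -> forall x y, digon_chain_of s x y -> D1 x y && D2 x y].
Proof.
move=> nD1 nD2; pose u x := outdeg D1 x + outdeg D2 x.
have [s [us sT us_sorted]] := ex_sorted_enum u.
pose h := #|T|./2; pose d x := chain_deg #|T| (index x s).
pose X j := \sum_(x in prefix_set s j.*2) 2 * d x.
pose Y j := \sum_(x in prefix_set s j.*2) u x.
have le_pref k : k <= #|T| -> \sum_(x in prefix_set s k) u x
    + (\sum_(x in prefix_set s k) \sum_(y in ~: prefix_set s k) ~~ D1 x y
    + \sum_(x in prefix_set s k) \sum_(y in ~: prefix_set s k) ~~ D2 x y)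
    <= \sum_(x in prefix_set s k) 2 * d x.
  move=> lek; have := outdeg_prefix nD1 us sT lek.
  have := outdeg_prefix nD2 us sT lek.
  by rewrite /u /d big_split -big_distrr /=; lia.
have le_h j : j <= h -> j.*2 <= #|T|.
  by rewrite /h; have := odd_double_half #|T|; lia.
have leYX j : j <= h -> Y j <= X j.
  by move/le_h/le_pref; apply: leq_trans (leq_addr _ _).
exists s, (\sum_(j < h.+1) (X j - Y j)); split=> //.
- have : \sum_x d x * u x + \sum_(j < h.+1) (X j - Y j) <= 2 * \sum_x d x ^ 2.
    exact: sum_prefix_gap us sT leYX.
  have : \sum_x u x ^ 2 <= \sum_x u x * (2 * d x).
    apply: sum_sq_le_prefix us_sorted _ => // k /le_pref.
    by apply: leq_trans (leq_addr _ _).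
  have -> : \sum_x u x * (2 * d x) = 2 * \sum_x d x * u x.
    by rewrite big_distrr; apply: eq_bigr => x _ /=; lia.
  have : 4 * \sum_x outdeg D1 x * outdeg D2 x <= \sum_x u x ^ 2.
    rewrite big_distrr; apply: leq_sum => x _ /=; rewrite /u.
    by case: (leqP (outdeg D1 x) (outdeg D2 x)) => ?; nia.
  by rewrite -[\sum_x chain_deg _ _ ^ 2]/(\sum_x d x ^ 2); lia.
- have leh x : block s x <= h.
    have := block_double_lt x us sT; rewrite /h.
    by have := odd_double_half #|T|; lia.
  rewrite (eq_bigr (fun x => \sum_y ~~ D1 x y * (block s y - block s x)
      + \sum_y ~~ D2 x y * (block s y - block s x))); last first.
    by move=> x _; rewrite -big_split; apply: eq_bigr => y _; rewrite mulnDl.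
  rewrite big_split -!(sum_missing_across _ leh) -big_split /=.
  apply: leq_sum => j _; have := le_pref j.*2 (le_h j _).
  by rewrite -ltnS ltn_ord => /(_ isT); rewrite -/(X j) -/(Y j); lia.
move=> G0; apply: chain_sub_of_tight => // j lejh.
suff : Y j = X j by [].
have := leYX j lejh; have : X j - Y j <= 0.
  by rewrite -G0 (bigD1 (Ordinal (lejh : j < h.+1))) //= leq_addr.
lia.
Qed.

(** * Counting admissible triples *)

Lemma card_triples (T : finType) (P : pred (T * T * T)) :
  #|[set t | P t]| = \sum_y \sum_x \sum_z P (x, y, z).
Proof.
rewrite exchange_big pair_big pair_big /= -sum1dep_card big_mkcond /=.
by apply: eq_bigr => -[[x y] z] _ /=; case: (P _).
Qed.

Lemma card_cherries (T : finType) (D1 D2 : rel T) :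
  #|[set t : T * T * T | let: (x, y, z) := t in D1 y x && D2 y z]|
    = \sum_y outdeg D1 y * outdeg D2 y.
Proof.
rewrite card_triples; apply: eq_bigr => y _; rewrite /outdeg big_distrl /=.
apply: eq_bigr => x _; rewrite big_distrr; apply: eq_bigr => z _ /=.
by rewrite mulnb.
Qed.

Lemma sum_block_window (T : finType) (s : seq T) b g : uniq s -> s =i T ->
  \sum_y (b <= block s y < b + g) <= g.*2.
Proof.
move=> us sT; rewrite (sum_index (fun i => b <= i./2 < b + g)) //.
(* The induction runs on the exact count; the minima cut the window off at the end of the list. *)
suff : \sum_(i < #|T|) (b <= i./2 < b + g) =
    minn #|T| (b + g).*2 - minn #|T| b.*2 by lia.
elim: #|T| => [|n IHn]; first by rewrite big_ord0; lia.
by rewrite big_ord_recr /= IHn; have := odd_double_half n; lia.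
Qed.

Definition missing (T : finType) (J D : rel T) : nat :=
  \sum_x \sum_y (J x y && ~~ D x y).

(* Arcs between blocks at distance less than [g] are given up; the others weigh
   at least [g] in the last sum. *)
Lemma missing_chain_le (T : finType) (D : rel T) (s : seq T) g :
  uniq s -> s =i T ->
  g * missing (digon_chain_of s) D <=
    2 * g ^ 2 * #|T| + \sum_x \sum_y ~~ D x y * (block s y - block s x).
Proof.
move=> us sT; rewrite /missing big_distrr /=.
have -> : 2 * g ^ 2 * #|T| = \sum_(x : T) g * g.*2.
  by rewrite sum_nat_const [RHS]mulnC; congr (_ * _); lia.
rewrite -big_split; apply: leq_sum => x _ /=.
apply: leq_trans (leq_add (leq_mul (leqnn g)
  (sum_block_window (block s x) g us sT)) (leqnn _)).
rewrite !big_distrr /= -big_split; apply: leq_sum => y _ /=.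
rewrite digon_chain_of_leq; case: (D x y); rewrite ?andbF ?muln0 //= andbT mul1n.
by case: (y != x); case: leqP => //=; case: ltnP; lia.
Qed.

(** A chain triple outside [A] either has both its arcs in [D1] and [D2], or uses a missing arc,
    with [#|T|] choices for the remaining color. *)
Lemma card_chain_minus (T : finType) (A : {set T * T * T}) (D1 D2 J : rel T) :
  (forall x y z, (x, y, z) \in A -> D1 y x && D2 y z) ->
  #|admissible (chain_palette J) :\: A| + #|A| <=
    \sum_y outdeg D1 y * outdeg D2 y + #|T| * (missing J D1 + missing J D2).
Proof.
move=> AD; rewrite -card_cherries; set B := [set _ | _].
have sAB : A \subset B by apply/subsetP => -[[x y] z] /AD; rewrite inE.
pose C := [set t : T * T * T | let: (x, y, z) := t in
  (J y x && ~~ D1 y x) || (J y z && ~~ D2 y z)].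
have sub : admissible (chain_palette J) :\: A \subset (B :\: A) :|: C.
  apply/subsetP => -[[x y] z]; rewrite !inE => /andP[-> /andP[-> ->]] /=.
  by case: (D1 _ _); case: (D2 _ _).
have cC : #|C| <= #|T| * (missing J D1 + missing J D2).
  rewrite card_triples mulnDr /missing !big_distrr -big_split /=.
  apply: leq_sum => y _; rewrite !big_distrr /=.
  have -> : \sum_x #|T| * (J y x && ~~ D1 y x) =
      \sum_x \sum_(z : T) (J y x && ~~ D1 y x).
    by apply: eq_bigr => x _; rewrite sum_nat_const.
  have -> : \sum_z #|T| * (J y z && ~~ D2 y z) =
      \sum_(x : T) \sum_z (J y z && ~~ D2 y z).
    rewrite exchange_big; apply: eq_bigr => z _ /=.
    by rewrite sum_nat_const.
  rewrite -big_split; apply: leq_sum => x _ /=.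
  rewrite -big_split; apply: leq_sum => z _ /=.
  by do 2 case: (_ && _).
have cB : #|A| + #|B :\: A| = #|B| by have := cardsID A B; rewrite (setIidPr sAB).
apply: (leq_trans (leq_add (subset_leq_card sub) (leqnn _))).
apply: (leq_trans (leq_add (leq_card_setU _ _).1 (leqnn _))).
by rewrite -cB addnAC [#|B :\: A| + _]addnC leq_add2l.
Qed.

(** Since [#|A :\: B| + #|B| = #|B :\: A| + #|A|], only one of the two differences has to be
    bounded. *)
Lemma card_symdiff_le (T : finType) (A B : {set T}) :
  #|symdiff A B| + #|B| <= 2 * #|B :\: A| + #|A|.
Proof.
have := (leq_card_setU (A :\: B) (B :\: A)).1; rewrite -/(symdiff A B).
by have := cardsID A B; have := cardsID B A; rewrite setIC; lia.
Qed.

(** The integer form of the result: [E] is $E_m$, [G] the total gap, [M] the number of chain arcs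
    missing from the two digraphs, and the distance threshold [g] is still free. *)
Lemma palette_chain_stability (P : palette) :
  let m := #|color P| in
  ~ palette_le paletteL P -> ~ palette_le paletteR P ->
  exists (J : rel (color P)) (E G M : nat),
    ordered_digon_chain J /\
    [/\ 3 * E + m = m ^ 3,
        2 * #|admissible P| + G <= 2 * E,
        forall g, g * M <= 4 * g ^ 2 * m + G,
        G = 0 -> M = 0 &
        #|symdiff (admissible P) (admissible (chain_palette J))|
          + 2 * #|admissible P| <= 2 * (E + m * M)].
Proof.
move=> m noL noR; set A := admissible P.
pose D1 y x := [exists z, (x, y, z) \in A].
pose D2 y z := [exists x, (x, y, z) \in A].
(* Homomorphisms may identify colors, so even a closed walk with repeated vertices yields one from
   [paletteL]. *)
have nD1 : no_closed_3walk D1.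
  move=> x y z /existsP[c1 A1] /existsP[c2 A2]; apply/negP => /existsP[c3 A3].
  apply: noL.
  (* Arcs of [D1] run from the second coordinate to the first, so the triangle follows the walk
     backwards. *)
  pose v (i : 'I_3) := if i == 0 :> nat then z else if i == 1 :> nat then y else x.
  pose c (i : 'I_3) := if i == 0 :> nat then c2 else if i == 1 :> nat then c1 else c3.
  exists (fun k => match k with inl i => v i | inr a => c (val a).1 end).
  move=> a b d /imsetP[[[i j] /= ij] _ [-> -> ->]] /=.
  by rewrite (eqP ij); case: i {ij} => -[|[|[|]]].
have nD2 : no_closed_3walk D2.
  move=> x y z /existsP[c1 A1] /existsP[c2 A2]; apply/negP => /existsP[c3 A3].
  apply: noR.
  pose v (i : 'I_3) := if i == 0 :> nat then x else if i == 1 :> nat then y else z.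
  pose c (i : 'I_3) := if i == 0 :> nat then c1 else if i == 1 :> nat then c2 else c3.
  exists (fun k => match k with inl i => v i | inr a => c (val a).1 end).
  move=> a b d /imsetP[[[i j] /= ij] _ [-> -> ->]] /=.
  by rewrite (eqP ij); case: i {ij} => -[|[|[|]]].
have AD x y z : (x, y, z) \in A -> D1 y x && D2 y z.
  by move=> xyz; apply/andP; split; apply/existsP; [exists z|exists x].
have [s [G [us sT leW leG tight]]] := chain_stability nD1 nD2.
pose J := digon_chain_of s; pose M := missing J D1 + missing J D2.
have EJ : #|admissible (chain_palette J)| = \sum_x chain_deg m (index x s) ^ 2.
  rewrite card_cherries; apply: eq_bigr => x _.
  by rewrite outdeg_chain // mulnn.
have leA : #|A| <= \sum_y outdeg D1 y * outdeg D2 y.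
  rewrite -card_cherries; apply: subset_leq_card.
  by apply/subsetP => -[[x y] z] /AD; rewrite inE.
exists J, (\sum_x chain_deg m (index x s) ^ 2), G, M.
split; first by exists s.
split.
- by rewrite (sum_index (fun i => chain_deg m i ^ 2) us sT) sum_chain_deg_sq.
- by move: leW; rewrite -/m; lia.
- move=> g; have := missing_chain_le D1 g us sT; have := missing_chain_le D2 g us sT.
  move: leG; rewrite -/m -/J /M.
  rewrite (eq_bigr (fun x => \sum_y ~~ D1 x y * (block s y - block s x)
      + \sum_y ~~ D2 x y * (block s y - block s x))); last first.
    by move=> x _; rewrite -big_split; apply: eq_bigr => y _; rewrite mulnDl.
  by rewrite big_split /=; lia.
- move=> /tight JD; rewrite /M /missing !big1 // => x _; rewrite big1 // => y _.
    by case Jxy : (J x y) => //=; case/andP: (JD _ _ Jxy) => _ ->.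
  by case Jxy : (J x y) => //=; case/andP: (JD _ _ Jxy) => ->.
have [b le_sd le_b] : exists2 b,
    #|symdiff A (admissible (chain_palette J))| + \sum_x chain_deg m (index x s) ^ 2
      <= 2 * b + #|A| &
    b + #|A| <= \sum_y outdeg D1 y * outdeg D2 y + m * M.
  exists #|admissible (chain_palette J) :\: A|; last exact: card_chain_minus.
  by rewrite -EJ; apply: card_symdiff_le.
by move: leW le_sd le_b leA; rewrite -/m -/A; lia.
Qed.

(** * Choice of the constants *)

Import Order.TTheory GRing.Theory Num.Theory.

Local Open Scope ring_scope.

Theorem theorem7p5 (R : realType) (eta : R) (eta_gt0 : 0 < eta) :
  exists eps : R, 0 < eps /\
    forall (m : nat) (P : palette),
      (1 <= m)%N ->
      #|color P| = m ->
      ~ palette_le paletteL P ->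
      ~ palette_le paletteR P ->
      m%:R * (m%:R ^+ 2 - 1) / 3 - eps * m%:R ^+ 3
        <= #|admissible P|%:R :> R ->
      exists J : rel (color P),
        ordered_digon_chain J /\
        #|symdiff (admissible P) (admissible (chain_palette J))|%:R
          <= eta * m%:R ^+ 3.
Proof.
(* Here 30 is 2 + 2 * 14: twice the deficit $E - a \le r m^3$, plus $2mM$ with $M \le 14 r m^2$. *)
pose r : R := Num.min 1 (eta / 30).
have r_gt0 : 0 < r by rewrite lt_min ltr01 /=; lra.
have r_le1 : r <= 1 by rewrite ge_min lexx.
have r_le : 30 * r <= eta by have : r <= eta / 30 by [rewrite ge_min lexx orbT]; lra.
exists (r ^+ 3); split; first exact: exprn_gt0.
move=> m P m_gt0 Pm noL noR; set a := #|admissible P|.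
have [J [E [G [M [chainJ []]]]]] := palette_chain_stability noL noR.
rewrite Pm -/a => hE hG hM hM0; set sd := #|symdiff _ _| => hsd large.
exists J; split=> //.
have {}hE : 3 * E%:R + m%:R = m%:R ^+ 3 :> R.
  by rewrite -natrX -hE natrD natrM.
have {}hG : 2 * a%:R + G%:R <= 2 * E%:R :> R.
  by rewrite -!natrM -natrD ler_nat.
have {}hsd : sd%:R + 2 * a%:R <= 2 * (E%:R + m%:R * M%:R) :> R.
  by rewrite -!(natrM, natrD) ler_nat.
have m_pos : 0 < m%:R :> R by rewrite ltr0n.
have rm3 : r ^+ 3 * m%:R ^+ 3 <= r * m%:R ^+ 3.
  rewrite ler_pM2r ?exprn_gt0 //.
  by rewrite -[leRHS]mulr1 exprS ler_pM2l // exprn_ile1 // ltW.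
have {}large : E%:R - a%:R <= r ^+ 3 * m%:R ^+ 3 by lra.
have r_le' : 30 * (r * m%:R ^+ 3) <= eta * m%:R ^+ 3.
  by rewrite mulrA ler_pM2r ?exprn_gt0.
have rm3_gt0 : 0 < r * m%:R ^+ 3 by rewrite mulr_gt0 ?exprn_gt0.
(* If [G] vanishes, no chain arc is missing. Otherwise $1 \le G \le 2 r^3 m^3$ forces $rm \ge 1/2$,
   so rounding $rm$ up costs only a constant factor. *)
have [G0|G_gt0] := posnP G.
  by move: hsd; rewrite (hM0 G0) mulr0 addr0 => hsd; lra.
have G1 : 1 <= G%:R :> R by rewrite ler1n.
have rm_ge : 1 <= 2 * (r * m%:R).
  rewrite leNgt; apply/negP => rm_lt.
  have : (r * m%:R) ^+ 3 < 2^-1 ^+ 3 by rewrite ltrXn2r // ?mulr_ge0 ?ltW //; lra.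
  by rewrite exprMn; lra.
have [g [g_gt le_g]] : exists g : nat, r * m%:R < g%:R /\ g%:R <= 3 * (r * m%:R).
  exists (Num.trunc (r * m%:R)).+1.
  have /andP[h1 h2] := truncn_itv (ltW (mulr_gt0 r_gt0 m_pos)).
  by split=> //; rewrite -natr1; lra.
have {hM} hM : g%:R * M%:R <= 4 * g%:R ^+ 2 * m%:R + G%:R :> R.
  by rewrite -!(natrX, natrM, natrD) ler_nat.
have g0 : 0 < g%:R :> R by lra.
(* The 14 is 4 * 3 from $4g^2m$ with $g \le 3rm$, plus 2 from $G \le 2r^2m^3$ with $g > rm$. *)
have : M%:R <= 14 * (r * m%:R ^+ 2).
  rewrite -(ler_pM2l g0); apply: (le_trans hM).
  have h1 : g%:R * g%:R * m%:R <= g%:R * (3 * (r * m%:R)) * m%:R.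
    by rewrite ler_pM2r ?ler_pM2l //; lra.
  have h2 : r * m%:R * (2 * (r * m%:R ^+ 2)) <= g%:R * (2 * (r * m%:R ^+ 2)).
    apply: ler_wpM2r; last exact: ltW.
    by rewrite !mulr_ge0 ?exprn_ge0 // ltW.
  have h3 : r ^+ 2 * m%:R ^+ 3 >= r ^+ 3 * m%:R ^+ 3.
    rewrite ler_pM2r ?exprn_gt0 //.
    by rewrite exprSr -[leRHS]mulr1 ler_pM2l ?exprn_gt0.
  lra.
move=> hM14.
have : m%:R * M%:R <= m%:R * (14 * (r * m%:R ^+ 2)) by rewrite ler_pM2l //; lra.
lra.
Qed.
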